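(* Let $X$ be an infinite-dimensional Banach space and let $\Lambda\leq X$ be a non-cobounded lattice, and consider the Diophantine space $(X,\mathbb{Q}\Lambda,H_{\mathrm{std}})$. For any function $\psi:(0,+\infty)\to(0,+\infty)$ with $\psi(q)\to 0$ as $q\to+\infty$, the set $\mathrm{BA}_\psi$ is prevalent. In particular, the Hausdorff dimension of $\mathrm{BA}_\psi$ is $+\infty$.
   Context: Banach spaces are real. A lattice in a Banach space $X$ is a subgroup $\Lambda\leq X$ which is topologically discrete (equivalently $\min_{p\in\Lambda\setminus\{0\}}\|p\|>0$) and such that $\mathbb{R}\Lambda$ is dense in $X$, or equivalently, no proper closed subspace of $X$ contains $\Lambda$. $\Lambda$ is cobounded if its codiameter $\mathrm{codiam}(\Lambda):=\sup\{\mathrm{dist}(x,\Lambda):x\in X\}$ is finite, and non-cobounded otherwise. $\mathbb{Q}\Lambda=\{p/q:p\in\Lambda,q\in\mathbb{N}\}$ with $\mathbb{N}=\{1,2,\ldots\}$, and $H_{\mathrm{std}}(r)=\min\{q\in\mathbb{N}:qr\in\Lambda\}$ for $r\in\mathbb{Q}\Lambda$. $\mathrm{BA}_\psi$ is the set of $x\in X$ for which there exists $\varepsilon>0$ such that $\|r-x\|\geq\varepsilon\,\psi(H_{\mathrm{std}}(r))$ for all $r\in\mathbb{Q}\Lambda$. A (Borel) measure $\mu$ on $X$ is transverse to a set $S\subset X$ if $\mu(S+v)=0$ for all $v\in X$; $S$ is shy if it is transverse to some compactly supported probability measure, and prevalent if its complement is shy. *)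

(* Defs.v *)
From HB Require Import structures.
From mathcomp Require Import all_boot all_order all_algebra.
From mathcomp Require Import all_classical all_reals all_analysis.

Set Implicit Arguments.
Unset Strict Implicit.
Unset Printing Implicit Defensive.

Import Order.TTheory GRing.Theory Num.Theory.
Import numFieldNormedType.Exports.

Local Open Scope classical_set_scope.
Local Open Scope ring_scope.

Definition linear_span (R : realType) (X : lmodType R) (A : set X) : set X :=
  [set x | exists n (a : 'I_n -> R) (p : 'I_n -> X),
    (forall i, A (p i)) /\ x = \sum_(i < n) a i *: p i].

Definition finite_dimensional (R : realType) (X : lmodType R) : Prop :=
  exists n (e : 'I_n -> X), linear_span (range e) = setT.

Record lattice (R : realType) (X : normedModType R) (L : set X) : Prop := {
  lattice0 : L 0;
  latticeB : forall p q, L p -> L q -> L (p - q);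
  lattice_discrete : L `<=` isolated L;
  lattice_dense : dense (linear_span L)
}.

Definition codiam (R : realType) (X : normedModType R) (L : set X) : \bar R :=
  ereal_sup (range (edist_inf L)).

Definition cobounded (R : realType) (X : normedModType R) (L : set X) : Prop :=
  (codiam L < +oo)%E.

Definition rational_points (R : realType) (X : normedModType R) (L : set X) :
    set X :=
  [set r | exists p (q : nat), [/\ L p, (0 < q)%N & r = q%:R^-1 *: p]].

(* The least positive denominator of r; the value outside the rational points
   is the irrelevant default 0. *)
Definition Hstd (R : realType) (X : normedModType R) (L : set X) (r : X) : nat :=
  xget 0%N [set q : nat | [/\ (0 < q)%N, L (q%:R *: r) &
    forall q' : nat, (0 < q')%N -> L (q'%:R *: r) -> (q <= q')%N]].

(* BA_psi of the Diophantine space (X, Q, H) *)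
Definition badly_approximable (R : realType) (X : normedModType R)
    (Q : set X) (H : X -> R) (psi : R -> R) : set X :=
  [set x | exists2 e : R, 0 < e &
    forall r, Q r -> `|r - x| >= e * psi (H r)].

Notation borelType X := (g_sigma_algebraType (@open X)).

(* S + v need not be Borel: it is null when it lies in a Borel mu-null set,
   which is the same as mu (S + v) = 0 when S is Borel. *)
Definition transverse (R : realType) (X : normedModType R)
    (mu : set (borelType X) -> \bar R) (S : set X) : Prop :=
  forall v : X, mu.-negligible [set s + v | s in S].

Definition compactly_supported (R : realType) (X : normedModType R)
    (mu : set (borelType X) -> \bar R) : Prop :=
  exists2 K : set X, compact K & mu (~` K) = 0%E.

Definition shy (R : realType) (X : normedModType R) (S : set X) : Prop :=
  exists mu : probability (borelType X) R,
    compactly_supported mu /\ transverse mu S.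

Definition prevalent (R : realType) (X : normedModType R) (S : set X) : Prop :=
  shy (~` S).

(* 0 is thrown in so that the diameter of the empty set is 0, not -oo. *)
Definition diam (R : realType) (X : pseudoMetricType R) (A : set X) : \bar R :=
  ereal_sup (0%E |` [set edist (x, y) | x in A & y in A]).

Definition hausdorff_premeasure (R : realType) (X : pseudoMetricType R)
    (s delta : R) (S : set X) : \bar R :=
  ereal_inf [set (\sum_(0 <= i <oo) (diam (U i) `^ s))%E |
    U in [set U : nat -> set X |
      S `<=` \bigcup_i U i /\ forall i, (diam (U i) <= delta%:E)%E]].

Definition hausdorff_measure (R : realType) (X : pseudoMetricType R)
    (s : R) (S : set X) : \bar R :=
  ereal_sup [set hausdorff_premeasure s delta S |
    delta in [set delta : R | 0 < delta]].

(* Restricting to s > 0 does not change the infimum and avoids a convention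
   for 0 ^ 0; the infimum is +oo when no s has hausdorff_measure s S = 0. *)
Definition hausdorff_dim (R : realType) (X : pseudoMetricType R) (S : set X) :
    \bar R :=
  ereal_inf [set s%:E | s in
    [set s : R | 0 < s /\ hausdorff_measure s S = 0%E]].

(* Main.v *)
Require Import Defs.
From HB Require Import structures.
From mathcomp Require Import all_boot all_order all_algebra.
From mathcomp Require Import all_classical all_reals all_analysis.
From mathcomp Require Import measurable_realfun ring lra.

Set Implicit Arguments.
Unset Strict Implicit.
Unset Printing Implicit Defensive.

Import Order.TTheory GRing.Theory Num.Theory.
Import numFieldNormedType.Exports.

Local Open Scope classical_set_scope.
Local Open Scope ring_scope.

(** Write L for the lattice.  If q divides M then q^-1 L is contained in
    M^-1 L, so a single lower bound on the distance from x to M^-1 L, with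
    M = m!, controls all denominators q <= m at once.  It therefore suffices
    to find constants c_j > 0 such that, for every translate and almost every
    x, the distance from x to (m_j)!^-1 L is at least c_j for all large j,
    where m_j is such that psi (q) <= c_(j+1) for all q > m_j
    ([badly_approximable_scales]).  This requires constants c_j that do not
    depend on the m_j.

    Since L is not cobounded, at every scale eta and for every M there is a
    vector u with N |u| <= eta whose multiples u, 2 u, ..., N u all stay at
    distance at least eta / (2 N) from M^-1 L ([noncobounded_probe]).  Hence,
    whatever the translate v, at most one of the points v, v + u, ...,
    v + (N - 1) u can be close to M^-1 L, and choosing among them uniformly
    at random has probability at most 1 / N of being close.

    The measure is the law of a random series with independent terms
    k_j u_j + y_j, where k_j is uniform among 2 ^ j values.  The bad event at
    step j has probability at most 2 ^ - j ([near_lattice_measure]), and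
    Borel-Cantelli gives prevalence; the terms of the series are dominated by
    a fixed convergent series, so its values lie in a compact set
    ([compact_series]).

    The other component y_j serves the Hausdorff dimension.  As X is
    infinite-dimensional, a ball contains arbitrarily many points that are
    separated by half its radius ([separated_points]); y_j is uniform on such
    a family, taken so large that the law gives mass at most r ^ s to every
    small ball of radius r, whatever s ([point_cball]).  The law gives full
    mass to BA_psi, so the mass distribution principle
    ([hausdorff_dim_frostman]) makes the dimension infinite.

    Independence is realised on [0, 1] with the uniform probability: the
    terms are functions of the digits of t in a mixed-radix expansion. *)

(** * Probes of a non-cobounded lattice *)

Lemma edist_norm (R : realType) (X : normedModType R) (x y : X) :
  edist (x, y) = `|x - y|%:E.
Proof.
apply/eqP; rewrite eq_le; apply/andP; split.
  apply/lee_addgt0Pr => e e0; rewrite -EFinD; apply: edist_fin => /=.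
    by rewrite ltr_wpDl.
  by rewrite -ball_normE /ball_/= ltrDl.
apply: le_ereal_inf_tmp => _ /= [r [_ +] <-].
by rewrite -ball_normE /ball_/= lee_fin => /ltW.
Qed.

Lemma noncobounded_far (R : realType) (X : normedModType R) (L : set X)
    (D : R) : ~ cobounded L -> exists y : X, forall p, L p -> D <= `|y - p|.
Proof.
move=> ncb; apply: contrapT => /forallNP near; apply: ncb.
rewrite /cobounded; apply: (@le_lt_trans _ _ D%:E); last exact: ltry.
apply: ge_ereal_sup => _ [y _ <-].
have /existsNP[p /not_implyP[Lp /negP]] := near y.
rewrite -ltNge => yp; apply: le_trans (ereal_inf_lbound _) _.
  by exists p.
by rewrite edist_norm lee_fin ltW.
Qed.

(** Pick y far from L and subtract a nearly closest point of L: the result w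
    has norm barely larger than its distance to L.  By the triangle
    inequality the distance to L then grows almost at full speed along the
    segment from 0 to w, which is rescaled to length M eta and divided into
    N steps. *)
Lemma noncobounded_probe (R : realType) (X : normedModType R) (L : set X)
    (M N : nat) (eta : R) :
  ~ cobounded L -> L !=set0 -> (forall p q, L p -> L q -> L (p - q)) ->
  (0 < M)%N -> (0 < N)%N -> 0 < eta ->
  exists u : X, N%:R * `|u| <= eta /\
    forall k p, (0 < k <= N)%N -> L p ->
      eta / (2 * N%:R) <= `|k%:R *: u - M%:R^-1 *: p|.
Proof.
move=> ncb [l0 Ll0] LB M0 N0 e0.
have M0' : 0 < M%:R :> R by rewrite ltr0n.
have N0' : 0 < N%:R :> R by rewrite ltr0n.
have L0 : L 0 by rewrite -(subrr l0); exact: LB.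
have LD p q : L p -> L q -> L (p + q).
  move=> Lp Lq; rewrite -(opprK q) -(sub0r q).
  exact: (LB _ _ Lp (LB _ _ L0 Lq)).
pose D := M%:R * eta; have D0 : 0 < D by rewrite mulr_gt0.
have [y yD] := noncobounded_far D ncb.
pose E := [set `|y - p| | p in L].
have infE : has_inf E.
  by split; [exists `|y - l0|, l0|exists D => _ [p Lp <-]; exact: yD].
have dD : D <= inf E.
  by apply: lb_le_inf => [|_ [p Lp <-]]; [exact: infE.1|exact: yD].
(* The near-minimality defect a D costs half of one step, of length D / N. *)
set a := (2 * N%:R)^-1 : R.
have a0 : 0 < a by rewrite invr_gt0 mulr_gt0.
have [_ [p0 Lp0 <-] yp0] := inf_adherent (mulr_gt0 a0 D0) infE.
set w : X := y - p0 in yp0.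
have wfar p : L p -> inf E <= `|w - p|.
  move=> Lp; rewrite /w -addrA -opprD; apply: ge_inf infE.2 _ _.
  by exists (p0 + p) => //; exact: LD.
have wD : D <= `|w| by rewrite (le_trans dD)// -(subr0 w) wfar.
have w0 : 0 < `|w| by exact: lt_le_trans wD.
pose th := D / `|w|.
have th0 : 0 <= th by rewrite divr_ge0 ?ltW.
have th1 : th <= 1 by rewrite ler_pdivrMr// mul1r.
exists ((th / (N%:R * M%:R)) *: w); split.
  rewrite normrZ ger0_norm ?(divr_ge0, mulr_ge0) ?ler0n ?normr_ge0 ?(ltW e0)//.
  rewrite /th /D le_eqVlt; apply/orP; left; apply/eqP.
  by field; rewrite !gt_eqF.
move=> k p /andP[k0 kN] Lp.
pose s : R := k%:R / N%:R.
have s0 : N%:R^-1 <= s by rewrite ler_peMl ?invr_ge0 ?(ltW N0')// ler1n.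
have s1 : s <= 1 by rewrite ler_pdivrMr// mul1r ler_nat.
have -> : k%:R *: ((th / (N%:R * M%:R)) *: w) - M%:R^-1 *: p =
    M%:R^-1 *: ((s * th) *: w - p).
  rewrite [RHS]scalerBr; congr (_ - _); rewrite !scalerA; congr (_ *: _).
  by rewrite /s; field; rewrite !gt_eqF.
rewrite normrZ ger0_norm ?invr_ge0 ?(ltW M0')// ler_pdivlMl//.
have -> : (s * th) *: w - p = (w - p) - (1 - s * th) *: w.
  by rewrite scalerBl scale1r opprB [RHS]addrC addrA subrK.
apply: le_trans (lerB_dist _ _).
have sth : s * th <= 1 by rewrite mulr_ile1// (le_trans _ s0)// invr_ge0 ltW.
rewrite normrZ [`|1 - _|]ger0_norm ?subr_ge0//.
have -> : (1 - s * th) * `|w| = `|w| - s * D.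
  by rewrite mulrBl mul1r -mulrA /th divfK// gt_eqF.
have sD : N%:R^-1 * D <= s * D by rewrite ler_wpM2r// ltW.
have := wfar p Lp.
have -> : M%:R * (eta / (2 * N%:R)) = a * D by rewrite /a /D; ring.
have : N%:R^-1 * D = 2 * (a * D) by rewrite /a; field; rewrite gt_eqF.
lra.
Qed.

(** * Separated points in infinite dimension *)

(** Replacing z by z - |z| e_i at least halves the norm, so iterating from x
    exhausts x; as there are finitely many e_i, the subtracted terms can be
    grouped into convergent scalar series, one for each i.  Hence x lies in
    the span itself and not only in its closure. *)
Lemma finite_dimensional_net (R : realType) (X : normedModType R) n
    (e : 'I_n -> X) :
  (forall x : X, `|x| <= 1 -> exists i, `|x - e i| <= 2^-1) ->
  finite_dimensional X.
Proof.
move=> net; exists n, e; apply/seteqP; split => // x _.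
have step (z : X) : exists i, `|z - `|z| *: e i| <= `|z| / 2.
  have [->|z0] := eqVneq z 0.
    have [|i _] := net 0; first by rewrite normr0.
    by exists i; rewrite normr0 scale0r subr0 normr0 mul0r.
  have nz0 : 0 < `|z| by rewrite normr_gt0.
  have [|i zi] := net (`|z|^-1 *: z).
    by rewrite normrZ normfV normr_id mulVf// gt_eqF.
  exists i; have zE : z = `|z| *: (`|z|^-1 *: z).
    by rewrite scalerA mulfV ?scale1r// gt_eqF.
  by rewrite {1}zE -scalerBr normrZ normr_id ler_wpM2l.
have [c cP] := choice step.
pose r m := iter m (fun z => z - `|z| *: e (c z)) x.
pose a k m := \sum_(l < m) (if c (r l) == k then `|r l| else 0).
have rE m : r m.+1 = r m - `|r m| *: e (c (r m)) by [].
have rS m : `|r m.+1| <= `|r m| / 2 by exact: cP.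
have xE m : x = r m + \sum_k a k m *: e k.
  elim: m => [|m IH].
    by rewrite big1 ?addr0// => k _; rewrite /a big_ord0 scale0r.
  have -> : \sum_k a k m.+1 *: e k =
      \sum_k a k m *: e k + `|r m| *: e (c (r m)).
    under eq_bigr => k _ do rewrite /a big_ord_recr/= scalerDl.
    rewrite big_split/=; congr (_ + _).
    rewrite (bigD1 (c (r m)))//= eqxx big1 ?addr0//.
    by move=> k /negbTE; rewrite eq_sym => ->; rewrite scale0r.
  by rewrite rE addrA addrAC subrK -IH.
have sumr m : \sum_(l < m) `|r l| + 2 * `|r m| <= 2 * `|x|.
  elim: m => [|m IH]; first by rewrite big_ord0 add0r.
  by rewrite big_ord_recr/=; move: IH (rS m) => /=; lra.
have r0 : r @ \oo --> (0 : X).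
  apply/cvgr0Pnorm_le => eps eps0.
  have rn m : `|r m| <= 2^-1 ^+ m * `|x|.
    elim: m => [|m IH]; first by rewrite expr0 mul1r.
    by rewrite (le_trans (rS m))// exprS mulrC -mulrA ler_wpM2l.
  have : (2^-1 ^+ m * `|x| @[m --> \oo] --> (0 : R)).
    rewrite -(mul0r `|x|); apply: cvgM; last exact: cvg_cst.
    apply: cvg_expr.
    by rewrite ger0_norm//; lra.
  move=> /cvgr0Pnorm_le/(_ _ eps0); apply: filterS => m.
  rewrite ger0_norm ?mulr_ge0 ?exprn_ge0//.
  exact: le_trans.
have ac k : cvgn (a k).
  apply: nondecreasing_is_cvgn.
    apply/nondecreasing_seqP => m; rewrite /a big_ord_recr/= lerDl.
    by case: ifP.
  exists (2 * `|x|) => _ [m _ <-].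
  rewrite (le_trans _ (sumr m))// (@le_trans _ _ (\sum_(l < m) `|r l|))//.
    by apply: ler_sum => l _; case: ifP.
  by rewrite lerDl mulr_ge0.
exists n, (fun k => limn (a k)), e; split; first by move=> i; exists i.
have cx : (r m + \sum_k a k m *: e k) @[m --> \oo] -->
    0 + \sum_k limn (a k) *: e k.
  apply: cvgD => //; apply: cvg_big => [|k _]; first exact: add_continuous.
  by apply: cvgZr_tmp; exact: ac.
rewrite -[RHS]add0r; apply: (cvg_unique _ _ cx) => //.
rewrite (_ : (fun m => _) = fun=> x); first exact: cvg_cst.
by apply/funext => m; exact/esym/xE.
Qed.

(** A family that could not be extended would be a finite net as in
    [finite_dimensional_net], up to rescaling the ball. *)
Lemma separated_points (R : realType) (X : normedModType R) (rho : R) n :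
  ~ finite_dimensional X -> 0 < rho ->
  exists y : nat -> X, (forall l, `|y l| <= rho) /\
    forall l l', (l < n)%N -> (l' < n)%N -> l != l' ->
      rho / 2 <= `|y l - y l'|.
Proof.
move=> infX rho0; elim: n => [|n [y [yr ysep]]].
  by exists (fun=> 0); split => // l; rewrite normr0 ltW.
have [x x1 xfar] : exists2 x : X, `|x| <= 1 &
    forall i : 'I_n, 2^-1 < `|x - rho^-1 *: y i|.
  apply: contrapT => nx; apply: infX.
  apply: (@finite_dimensional_net _ _ n (fun i => rho^-1 *: y i)) => x x1.
  apply: contrapT => /forallNP nxi; apply: nx; exists x => // i.
  by rewrite ltNge; apply/negP; exact: nxi.
have far (i : nat) : (i < n)%N -> rho / 2 <= `|rho *: x - y i|.
  move=> ni; have -> : rho *: x - y i = rho *: (x - rho^-1 *: y i).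
    by rewrite [RHS]scalerBr scalerA mulfV ?scale1r// gt_eqF.
  rewrite normrZ (gtr0_norm rho0) ler_pM2l//; exact/ltW/(xfar (Ordinal ni)).
exists (fun l => if l == n then rho *: x else y l); split => [l|l l'].
  case: ifP => _ //; rewrite normrZ (gtr0_norm rho0) -[leRHS]mulr1.
  by rewrite ler_wpM2l// ltW.
rewrite !ltnS; case: (eqVneq l n) => [->|ln]; case: (eqVneq l' n) => [->|l'n].
- by [].
- by move=> _ l'n' _; apply: far; rewrite ltn_neqAle l'n.
- by move=> ln' _ _; rewrite distrC; apply: far; rewrite ltn_neqAle ln.
- by move=> ln' l'n'; apply: ysep; rewrite ltn_neqAle ?ln ?l'n.
Qed.

(** * Mixed-radix digits of a uniform random number *)

Lemma uniform_prob01 (R : realType) (U : set R) : measurable U ->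
  uniform_prob (@ltr01 R) U = lebesgue_measure (U `&` `[0, 1]).
Proof.
move=> mU; rewrite /uniform_prob integral_uniform_pdf.
rewrite (eq_integral (cst 1%E)).
  by rewrite integral_cst ?mul1e//; exact: measurableI.
move=> x; rewrite inE/= in_itv/= => -[_ x01].
by rewrite /uniform_pdf x01 subr0 invr1.
Qed.

(** Expanding to one more digit refines the expansion: the coarse cell index
    is the quotient of the finer one. *)
Lemma truncn_divn (R : realType) (x : R) (q : nat) : (0 < q)%N ->
  Num.truncn x = (Num.truncn (x * q%:R) %/ q)%N.
Proof.
move=> q0; have q0' : 0 < q%:R :> R by rewrite ltr0n.
have [x0|x0] := leP 0 x; last first.
  have tr0 (y : R) : y < 0 -> Num.truncn y = 0%N.
    by move=> y0; apply/truncn0Pn; rewrite -ltNge (lt_trans y0).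
  by rewrite !tr0 ?div0n// nmulr_rlt0.
set m := Num.truncn (x * _); apply: truncn_def.
have /andP[ml mr] : m%:R <= x * q%:R < m.+1%:R 
  by apply: truncn_itv; rewrite mulr_ge0.
apply/andP; split; rewrite -(ltr_pM2r q0', ler_pM2r q0') -natrM.
  by apply: le_trans ml; rewrite ler_nat leq_divM.
by apply: lt_le_trans mr _; rewrite ler_nat ltn_ceil.
Qed.

Section code.
Context {R : realType} (Q : nat -> nat).

Definition card_code n := (\prod_(i < n) Q i)%N.

(** [code n t] is the index of the cell containing t in the division of
    [0, 1[ into [card_code n] equal cells, that is, the word of the first n
    digits of t.  The reduction modulo [card_code n] makes the bound
    [code_lt] hold for every real t. *)
Definition code n (t : R) : nat :=
  (Num.truncn ((card_code n)%:R * t) %% card_code n)%N.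

Lemma card_code0 : card_code 0 = 1%N. Proof. exact: big_ord0. Qed.

Lemma card_codeS n : card_code n.+1 = (card_code n * Q n)%N.
Proof. exact: big_ord_recr. Qed.

Lemma measurable_code n (S : set nat) : measurable [set t | S (code n t)].
Proof.
set a : R := (card_code n)%:R.
have mge k : measurable [set t : R | (k <= Num.truncn (a * t))%N].
  case: k => [|k].
    by rewrite (_ : [set t | _] = setT)//; apply/seteqP; split.
  have -> : [set t | (k.+1 <= Num.truncn (a * t))%N] =
      [set: R] `&` *%R a @^-1` `[k.+1%:R, +oo[.
    apply/seteqP; split => t /=; rewrite truncn_gt_nat in_itv/= andbT => //.
    by case.
  by apply: mulrl_measurable => //; exact: measurable_itv.
have meq k : measurable [set t : R | Num.truncn (a * t) = k].
  rewrite (_ : [set t | _] = [set t | (k <= Num.truncn (a * t))%N] `\`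
    [set t | (k.+1 <= Num.truncn (a * t))%N]); first exact: measurableD.
  apply/seteqP; split => t /=; first by move=> ->; rewrite ltnn leqnn.
  by move=> [h /negP]; rewrite -leqNgt => h'; apply/eqP; rewrite eqn_leq h'.
rewrite (_ : [set t | _] = \bigcup_(k in [set k | S (k %% card_code n)%N])
    [set t : R | Num.truncn (a * t) = k]); first exact: bigcup_measurable.
apply/seteqP; split => [t St|t [k /= Sk E]].
  by exists (Num.truncn (a * t)).
by rewrite /= /code -/a E.
Qed.

Hypothesis Q_gt0 : forall n, (0 < Q n)%N.

Lemma card_code_gt0 n : (0 < card_code n)%N.
Proof. by rewrite prodn_gt0. Qed.

Lemma code_lt n t : (code n t < card_code n)%N.
Proof. by rewrite ltn_pmod// card_code_gt0. Qed.

Lemma codeS n t : code n t = (code n.+1 t %/ Q n)%N.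
Proof.
rewrite /code card_codeS -modn_divl; congr (_ %% _)%N.
by rewrite (truncn_divn _ (Q_gt0 n)) natrM mulrAC.
Qed.

Lemma code_eq_le n m t t' : (n <= m)%N -> code m t = code m t' ->
  code n t = code n t'.
Proof.
move=> /subnK <-; elim: (m - n)%N => // k IH E.
by apply: IH; rewrite codeS -addSn E -codeS.
Qed.

Lemma uniform_code n m :
  (uniform_prob (@ltr01 R) [set t | code n t = m] <=
   ((card_code n)%:R^-1)%:E)%E.
Proof.
have a0 : 0 < (card_code n)%:R :> R by rewrite ltr0n card_code_gt0.
have mC := measurable_code n [set m].
rewrite uniform_prob01//.
set a : R := (card_code n)%:R.
apply: (@le_trans _ _
    (lebesgue_measure (`[m%:R / a, m.+1%:R / a]%classic `|` [set (1 : R)]))).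
  apply: le_measure; rewrite ?inE.
  - exact: measurableI.
  - exact: measurableU.
  move=> t [/= <-]; rewrite in_itv/= => /andP[t0].
  (* The endpoint 1 wraps around to cell 0 but has measure zero. *)
  rewrite le_eqVlt => /predU1P[->|t1]; [by right|left].
  have at0 : 0 <= a * t by rewrite mulr_ge0// ltW.
  have tl : (Num.truncn (a * t) < card_code n)%N.
    by rewrite truncn_lt_nat// -/a -[ltRHS]mulr1 ltr_pM2l.
  rewrite /code -/a modn_small//= in_itv/= ler_pdivrMr// ler_pdivlMr//.
  by have /andP[] := truncn_itv at0; rewrite mulrC => -> /ltW.
apply: (@le_trans _ _
    (lebesgue_measure `[(m%:R / a)%R, (m.+1%:R / a)%R]%classic +
     lebesgue_measure [set 1%R])%E); first exact: measureU2.
rewrite lebesgue_measure_set1 adde0 lebesgue_measure_itv/=.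
case: ifP => _; last by rewrite lee_fin invr_ge0 ltW.
by rewrite -EFinD lee_fin -mulrBl -natrB// subSnn mul1r.
Qed.

End code.

(** The cells of level n + 1 are grouped by N into parents.  A set meeting at
    most one cell of every parent carries at most 1 / N of the mass: this is
    how a choice among N alternatives, conditionally on all other digits up
    to level n + 1, is turned into a probability bound. *)
Lemma uniform_code_parent {R : realType} {Q : nat -> nat}
    (Q_gt0 : forall n, (0 < Q n)%N) (n N N' : nat) (B : set R) :
  Q n = (N' * N)%N -> measurable B ->
  (forall t t', B t -> B t' ->
     (code Q n.+1 t %/ N = code Q n.+1 t' %/ N)%N ->
     code Q n.+1 t = code Q n.+1 t') ->
  (uniform_prob (@ltr01 R) B <= (N%:R^-1)%:E)%E.
Proof.
move=> QE mB Bpar.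
have : (0 < N' * N)%N by rewrite -QE.
rewrite muln_gt0 => /andP[N'0 N0].
pose K := (card_code Q n * N')%N.
pose s (i : nat) := xget 0%R [set t | B t /\ (code Q n.+1 t %/ N)%N = i].
pose C (i : nat) := [set t : R | code Q n.+1 t = code Q n.+1 (s i)].
have mC i : measurable (C i) by exact: (measurable_code Q n.+1 [set _]).
have BC : B `<=` \big[setU/set0]_(i < K) C i.
  move=> t Bt; rewrite -bigcup_mkord.
  exists (code Q n.+1 t %/ N)%N.
    rewrite /= ltn_divLR// /K -mulnA -QE -card_codeS.
    exact: code_lt.
  rewrite /C /=; set i := (_ %/ N)%N.
  have [|Bs si] := @xgetPex _ 0%R [set t | B t /\ (code Q n.+1 t %/ N)%N = i].
    by exists t.
  exact: Bpar.
apply: (@le_trans _ _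
    (uniform_prob (@ltr01 R) (\big[setU/set0]_(i < K) C i))).
  apply: le_measure => //; apply: mem_set => //.
  by apply: bigsetU_measurable => i _; exact: mC.
apply: (@le_trans _ _ (\sum_(i < K) uniform_prob (@ltr01 R) (C i))%E).
  by apply: Boole_inequality => i _; exact: mC.
apply: (@le_trans _ _ (\sum_(i < K) ((card_code Q n.+1)%:R^-1)%:E)%E).
  by apply: lee_sum => i _; exact: uniform_code.
rewrite sumEFin lee_fin sumr_const card_ord card_codeS QE mulnA -/K.
rewrite -[leLHS]mulr_natl natrM invfM mulrA mulfV ?mul1r// pnatr_eq0 -lt0n.
by rewrite muln_gt0 card_code_gt0.
Qed.

(** * Random series of dominated terms *)

Section dominated_series.
Context {R : realType} {X : completeNormedModType R} {tau : nat -> R}.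
Hypothesis tau_ge0 : forall n, 0 <= tau n.

(** The hypothesis that |c_n| + tau_(n+1) <= tau_n says that tau_n dominates
    the tails of the series; this telescoping form makes every tail estimate
    an immediate induction. *)
Lemma series_dist_le (c : nat -> X) (n k : nat) :
  (forall n, `|c n| + tau n.+1 <= tau n) ->
  `|series c (n + k)%N - series c n| <= tau n - tau (n + k)%N.
Proof.
move=> cb; elim: k => [|k IH]; first by rewrite addn0 !subrr normr0.
rewrite addnS (seriesSr c) addrAC.
apply: (le_trans (ler_normD _ _)).
by move: IH (cb (n + k)%N); lra.
Qed.

Lemma dominated_series_cvg (c : nat -> X) :
  (forall n, `|c n| + tau n.+1 <= tau n) -> cvgn (series c).
Proof.
move=> cb; apply: normed_cvg; apply: nondecreasing_is_cvgn.
  by apply: nondecreasing_series => k _ _; exact: normr_ge0.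
exists (tau 0) => _ [n _ <-].
suff h : \sum_(0 <= k < n) `|c k| <= tau 0%N - tau n.
  by apply: (le_trans h); rewrite gerBl.
elim: n => [|n IH]; first by rewrite big_geq// subrr.
by rewrite big_nat_recr//=; move: IH (cb n); lra.
Qed.

Lemma dominated_series_tail (c : nat -> X) n :
  (forall n, `|c n| + tau n.+1 <= tau n) ->
  `|limn (series c) - series c n| <= tau n.
Proof.
move=> cb; have cc := dominated_series_cvg cb.
have cn : `|series c m - series c n| @[m --> \oo] -->
    `|limn (series c) - series c n|.
  by apply: cvg_norm; apply: cvgB => //; exact: cvg_cst.
apply: (ler_cvg_to cn (cvg_cst (tau n))).
exists n => // m /= /subnKC <-.
by rewrite (le_trans (series_dist_le _ _ cb))// gerBl.
Qed.

(** The set is the image of a product of finite sets, compact by Tychonoff,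
    under the sum map, which is continuous for the product topology because
    the tails are uniformly small. *)
Lemma compact_series (A : nat -> set X) : tau @ \oo --> (0 : R) ->
  (forall n x, A n x -> `|x| + tau n.+1 <= tau n) ->
  (forall n, finite_set (A n)) ->
  compact [set limn (series c) | c in [set c : nat -> X | forall n, A n (c n)]].
Proof.
move=> tau0 Ab Afin.
pose T : topologicalType := prod_topology (fun _ : nat => X).
have cA : compact ([set c : T | forall n, A n (c n)]).
  by apply: tychonoff => n; exact: finite_compact.
pose f (c : T) : X := limn (series (c : nat -> X)).
suff : {within [set c : T | forall n, A n (c n)], continuous f}.
  by move=> /continuous_compact/(_ cA).
apply/subspace_continuousP => c Ac; apply/cvgrPdist_lt => e e0.
have e3 : 0 < e / 3 by rewrite divr_gt0.
have [n taun] : exists n, tau n < e / 3.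
  move/cvgrPdist_lt : tau0 => /(_ _ e3)[n _ /(_ n (leqnn n))].
  by rewrite sub0r normrN ger0_norm//; exists n.
have cs : \sum_(0 <= k < n) (c' : nat -> X) k @[c' --> nbhs (c : T)] -->
    series (c : nat -> X) n.
  rewrite /series/=; elim: {taun} n => [|n IH].
    by under eq_cvg do rewrite big_geq//; rewrite big_geq//; exact: cvg_cst.
  under eq_cvg do rewrite big_nat_recr//=.
  rewrite big_nat_recr//=; apply: cvgD => //.
  exact: (@proj_continuous _ (fun _ : nat => X) n c).
have /cvgrPdist_lt/(_ _ e3) := cs.
apply: filterS => c' cc' Ac'.
have h1 := dominated_series_tail n (fun k => Ab _ _ (Ac k)).
have h2 := dominated_series_tail n (fun k => Ab _ _ (Ac' k)).
rewrite /f; set x := limn _ in h1 *; set y := limn _ in h2 *.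
have -> : x - y = (x - series c n) + (series c n - series c' n) -
    (y - series c' n).
  by rewrite addrA subrK opprB addrA subrK.
apply: (le_lt_trans (ler_normB _ _)).
have := ler_normD (x - series c n) (series c n - series c' n).
by move: cc' => /=; lra.
Qed.

End dominated_series.

Section random_series.
Context {R : realType} {X : completeNormedModType R} {tau : nat -> R}.
Context {Q : nat -> nat} {w : nat -> nat -> X}.

Definition digit n (t : R) := (code Q n.+1 t %% Q n)%N.

Definition random_series (t : R) : X :=
  limn (series (fun n => w n (digit n t))).

Hypothesis tau_ge0 : forall n, 0 <= tau n.
Hypothesis tau_cvg0 : tau @ \oo --> (0 : R).
Hypothesis Q_gt0 : forall n, (0 < Q n)%N.
Hypothesis w_tau : forall n d, `|w n d| + tau n.+1 <= tau n.

Lemma digit_inj n t t' : code Q n t = code Q n t' ->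
  digit n t = digit n t' -> code Q n.+1 t = code Q n.+1 t'.
Proof.
rewrite (codeS Q_gt0) (codeS Q_gt0 n t') => dE mE.
by rewrite (divn_eq (code Q n.+1 t) (Q n)) dE [(_ %% _)%N]mE -divn_eq.
Qed.

Lemma series_code_eq n t t' : code Q n t = code Q n t' ->
  series (fun n => w n (digit n t)) n = series (fun n => w n (digit n t')) n.
Proof.
move=> ctt'; rewrite /series/= !big_mkord; apply: eq_bigr => i _.
by rewrite /digit (code_eq_le Q_gt0 (ltn_ord i) ctt').
Qed.

Lemma random_series_tail n t :
  `|random_series t - series (fun n => w n (digit n t)) n| <= tau n.
Proof. by apply: dominated_series_tail. Qed.

(** Points with the same first n digits differ by the difference of their
    n-th terms, up to two tails. *)
Lemma random_series_dist n t t' : code Q n t = code Q n t' ->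
  `|random_series t - random_series t' -
    (w n (digit n t) - w n (digit n t'))| <= 2 * tau n.+1.
Proof.
move=> /series_code_eq E.
have := random_series_tail n.+1 t; have := random_series_tail n.+1 t'.
rewrite !seriesSr E.
set x : X := random_series t; set x' : X := random_series t'.
set a' : X := w n (digit n t'); set a : X := w n (digit n t).
set s : X := series _ n => h' h.
have -> : a - a' = (s + a) - (s + a') by rewrite opprD addrACA subrr add0r.
have -> : x - x' - (s + a - (s + a')) = (x - (s + a)) - (x' - (s + a')).
  by rewrite !opprB addrACA [RHS]addrACA [- x' - _]addrC.
apply: le_trans (ler_normB _ _) _; lra.
Qed.

(** X may fail to be separable, and then a sum of Borel maps into X need not
    be Borel.  Instead, t belongs to the preimage of an open G as soon as,
    for some n, the ball of radius [tau n] around the n-th partial sum lies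
    in G, and this condition depends only on the first n digits of t. *)
Lemma measurable_random_series :
  measurable_fun setT (random_series : R -> borelType X).
Proof.
apply: measurability => // _ [G oG <-].
pose S n (m : nat) := exists t, [/\ code Q n t = m &
  forall x, `|x - series (fun n => w n (digit n t)) n| <= tau n -> G x].
rewrite setTI (_ : _ @^-1` _ = \bigcup_n [set t | S n (code Q n t)]).
  by apply: bigcup_measurable => n _; exact: measurable_code.
apply/seteqP; split => [t /= Gt|t [n _ [t' [tt' Gt']]]]; last first.
  by apply: Gt'; rewrite (series_code_eq tt'); exact: random_series_tail.
have /nbhs_ballP[e /= e0 eG] : nbhs (random_series t) G.
  by apply: open_nbhs_nbhs.
have e2 : 0 < e / 2 by rewrite divr_gt0.
move/cvgrPdist_lt : tau_cvg0 => /(_ _ e2)[n _ /(_ n (leqnn n))].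
rewrite sub0r normrN ger0_norm// => taun.
exists n => //; exists t; split => // x xn; apply: eG.
rewrite -ball_normE /ball_/=.
rewrite -(subrKA (series (fun n => w n (digit n t)) n)).
apply: (le_lt_trans (ler_normD _ _)).
have := random_series_tail n t; rewrite distrC in xn; lra.
Qed.

Lemma compact_random_series :
  exists2 K : set X, compact K & forall t, K (random_series t).
Proof.
pose A n := w n @` `I_(Q n).
exists [set limn (series c) | c in [set c : nat -> X | forall n, A n (c n)]].
  apply: (compact_series tau_ge0) => //; first by move=> n _ [d _ <-].
  by move=> n; apply: finite_image; exact: finite_II.
move=> t; exists (fun n => w n (digit n t)) => // n.
by exists (digit n t) => //=; rewrite ltn_pmod.
Qed.

Lemma random_series_law : exists2 mu : probability (borelType X) R,
  compactly_supported mu & forall A, mu A =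
    uniform_prob (@ltr01 R) (random_series @^-1` A).
Proof.
have mf : measurable_fun setT
  (random_series : measurableTypeR R -> borelType X) :=
  measurable_random_series.
pose f : {mfun (measurableTypeR R) >-> borelType X} := HB.pack
  (random_series : measurableTypeR R -> borelType X)
  (isMeasurableFun.Build _ _ _ _ _ mf).
exists (distribution (uniform_prob (@ltr01 R)) f) => //.
have [K cK Kf] := compact_random_series.
exists K => //.
rewrite /distribution /pushforward/= (_ : _ @^-1` _ = set0) ?measure0//.
by apply/seteqP; split => // t /=; apply; exact: Kf.
Qed.

End random_series.

(** * Borel sets and the mass distribution principle *)

Lemma open_borel (R : realType) (X : normedModType R) (A : set X) :
  open A -> measurable (A : set (borelType X)).
Proof. exact: sub_sigma_algebra. Qed.

Lemma closed_borel (R : realType) (X : normedModType R) (A : set X) :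
  closed A -> measurable (A : set (borelType X)).
Proof.
move=> cA; rewrite -[A]setCK; apply: measurableC.
by apply: open_borel; rewrite openC.
Qed.

Lemma measurable_cball (R : realType) (X : normedModType R) (x : X) (r : R) :
  measurable ([set y | `|y - x| <= r] : set (borelType X)).
Proof.
apply: closed_borel.
apply: (@closed_comp _ _ (fun y => `|y - x|) [set s | s <= r]) => [y _|].
  apply: (@continuous_comp _ _ _ (fun y => y - x) Num.norm).
    by apply: cvgB => //; exact: cvg_cst.
  exact: norm_continuous.
exact: closed_le.
Qed.

Section mass_distribution.
Context {R : realType} {X : normedModType R}.
Variable mu : probability (borelType X) R.

Definition frostman (s : R) := exists2 delta : R, 0 < delta &
  forall x r, 0 < r <= delta ->
    (mu [set y | (`|y - x| <= r)%R] <= (r `^ s)%:E)%E.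

(** A nonempty U lies in the closed ball of radius diam U around any of its
    points.  When the diameter is 0, that ball is reduced to a point and has
    zero mass, as seen by letting the radius of larger balls tend to 0. *)
Lemma frostman_diam s : 0 < s -> frostman s ->
  exists2 delta : R, 0 < delta & forall U : set X,
    (diam U <= delta%:E)%E ->
    exists C : set (borelType X),
      [/\ measurable C, U `<=` C & (mu C <= diam U `^ s)%E].
Proof.
move=> s0 [delta d0 fr]; exists delta => // U Ud.
have dU0 : (0 <= diam U)%E by apply: ereal_sup_ubound; left.
have [->|/set0P[x Ux]] := eqVneq U set0.
  by exists set0; split => //; rewrite measure0 poweR_ge0.
have [r dr] : exists r, diam U = r%:E.
  by move: Ud dU0; case: (diam U) => [r _ _||]//; exists r.
exists [set y | `|y - x| <= r]; split; first exact: measurable_cball.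
  move=> y Uy /=; rewrite -lee_fin -dr -edist_norm.
  by apply: ereal_sup_ubound; right; exists y => //; exists x.
rewrite dr poweR_EFin; rewrite dr !lee_fin in Ud dU0.
move: dU0; rewrite le_eqVlt => /predU1P[r0|r0]; last by apply: fr; rewrite r0.
rewrite -r0 powR0 ?gt_eqF//; apply/lee_addgt0Pr => e e0; rewrite add0e.
pose t := Num.min delta (e `^ s^-1).
have t0 : 0 < t by rewrite lt_min d0 powR_gt0.
apply: (@le_trans _ _ (mu [set y | (`|y - x| <= t)%R])).
  apply: le_measure; rewrite ?inE; [exact: measurable_cball..|].
  by move=> y /= /le_trans; apply; exact: ltW.
apply: le_trans (fr x t _) _; first by rewrite t0 ge_min lexx.
rewrite lee_fin.
have -> : e = (e `^ s^-1) `^ s by rewrite -powRrM mulVf ?powRr1 ?ltW// gt_eqF.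
have te : t <= e `^ s^-1 by rewrite /t ge_min lexx orbT.
by apply: (ge0_ler_powR (ltW s0)) te; rewrite nnegrE ?powR_ge0// ltW.
Qed.

(** A cover of S by small sets U_i, together with a null set, covers the whole
    space, so the sum of the diam U_i ^ s is at least 1. *)
Lemma hausdorff_dim_frostman (S : set X) : mu.-negligible (~` S) ->
  (forall s, 0 < s -> frostman s) -> hausdorff_dim S = +oo%E.
Proof.
move=> [A [mA muA SA]] fr.
rewrite /hausdorff_dim (_ : [set s : R | _] = set0) ?image_set0 ?ereal_inf0//.
apply/seteqP; split => // s [s0 Hs].
have [delta d0 Ud] := frostman_diam s0 (fr s s0).
have : (hausdorff_premeasure s delta S < 1)%E.
  apply: (@le_lt_trans _ _ 0%E) => //; rewrite -Hs.
  by apply: ereal_sup_ubound; exists delta.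
move=> /ereal_inf_lt[_ [U [SU dU] <-]].
have [C CP] := choice (fun i => Ud (U i) (dU i)).
apply/negP; rewrite -leNgt -(probability_setT mu).
have cov : setT `<=` A `|` \bigcup_i C i.
  move=> x _; have [Sx|nSx] := pselect (S x); last by left; exact: SA.
  right; have [i _ Uix] := SU x Sx; exists i => //.
  by have [_ + _] := CP i; apply.
have mC : measurable (\bigcup_i C i).
  by apply: bigcupT_measurable => i; have [] := CP i.
apply: (@le_trans _ _ (mu (A `|` \bigcup_i C i))).
  by apply: le_measure; rewrite ?inE//; exact: measurableU.
apply: (@le_trans _ _ (mu A + mu (\bigcup_i C i))%E); first exact: measureU2.
rewrite muA add0e.
apply: (@le_trans _ _ (\sum_(0 <= i <oo) mu (C i))%E).
  by apply: generalized_Boole_inequality => // i; have [] := CP i.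
by apply: lee_nneseries => // i *; have [_ _ Ci] := CP i; exact: Ci.
Qed.

End mass_distribution.

(** * The probing series *)

Section scales.
Context {R : realType}.

(** The amplitude of step n.  The factor is chosen so that three effects are
    well separated: the multiples of the probe keep a distance of at least
    eta_n / (2 * 2 ^ n) = 256 eta_(n+1) from M^-1 L, the spread points have
    norm at most 32 eta_(n+1) and separation 16 eta_(n+1), and two tails of
    the series amount to 8 eta_(n+1). *)
Definition eta n : R := \prod_(i < n) (512 * 2 ^+ i)^-1.

Lemma etaS n : eta n = 512 * 2 ^+ n * eta n.+1.
Proof.
have c0 : 512 * 2 ^+ n != 0 :> R.
  by apply: mulf_neq0; rewrite ?expf_neq0 ?pnatr_eq0.
by rewrite /eta big_ord_recr/= mulrCA mulfV ?mulr1 ?c0.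
Qed.

Lemma eta_gt0 n : 0 < eta n.
Proof.
rewrite /eta; apply: prodr_gt0 => i _.
by rewrite invr_gt0; apply: mulr_gt0; rewrite ?ltr0n// exprn_gt0 ?ltr0n.
Qed.

Lemma etaS_le n : 512 * eta n.+1 <= eta n.
Proof.
rewrite (etaS n) -mulrA ler_pM2l ?ltr0n// ler_peMl ?(ltW (eta_gt0 _))//.
by rewrite exprn_ege1 ?ler1n.
Qed.

Lemma eta_le m n : (m <= n)%N -> eta n <= eta m.
Proof.
move=> /subnK <-; elim: (n - m)%N => // k IH; apply: le_trans IH.
by have := etaS_le (k + m); have := eta_gt0 (k + m).+1; rewrite addSn; lra.
Qed.

Lemma eta_le1 n : eta n <= 1.
Proof. by rewrite (le_trans (eta_le (leq0n n)))// /eta big_ord0. Qed.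

Lemma eta_cvg0 : eta @ \oo --> 0.
Proof.
apply/cvgr0Pnorm_le => e e0.
have eta2 m : eta m <= 2^-1 ^+ m.
  elim: m => [|m IH]; first by rewrite expr0 eta_le1.
  by rewrite exprS; have := etaS_le m; have := eta_gt0 m.+1; lra.
have : (2^-1 ^+ m @[m --> \oo] --> (0 : R)).
  by apply: cvg_expr; rewrite ger0_norm//; lra.
move=> /cvgr0Pnorm_le/(_ _ e0); apply: filterS => m.
rewrite !ger0_norm ?exprn_ge0 ?(ltW (eta_gt0 _))//.
exact: le_trans.
Qed.

End scales.

Section probing_series.
Context {R : realType} {X : completeNormedModType R} {L : set X}.
Context {M : nat -> nat} {u : nat -> X} {y : nat -> nat -> X}.

(** With this many spread points at step n, a cell of level n + 1 has mass at
    most eta_(n+2) ^ n, a power of the next scale whose exponent tends to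
    infinity. *)
Definition card_spread n := (Num.truncn ((@eta R n.+2) ^- n)).+1.

Definition branching n := (card_spread n * 2 ^ n)%N.

(** A digit d < N' * 2 ^ n encodes a multiple of the probe, its remainder, and
    a spread point, its quotient. *)
Definition increment n d : X :=
  (d %% 2 ^ n)%:R *: u n + y n (d %/ 2 ^ n).
Notation point := (@random_series R X branching increment).
Notation code := (code branching).
Notation digit := (@digit R branching).

Hypothesis LB : forall p q, L p -> L q -> L (p - q).
Hypothesis u_small : forall n, (2 ^ n)%:R * `|u n| <= eta n.
Hypothesis u_far : forall n k p, (0 < k <= 2 ^ n)%N -> L p ->
  256 * eta n.+1 <= `|k%:R *: u n - (M n)%:R^-1 *: p|.
Hypothesis y_small : forall n l, `|y n l| <= 32 * eta n.+1.
Hypothesis y_far : forall n l l', (l < card_spread n)%N ->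
  (l' < card_spread n)%N -> l != l' -> 16 * eta n.+1 <= `|y n l - y n l'|.

Lemma branching_gt0 n : (0 < branching n)%N.
Proof. by rewrite muln_gt0 expn_gt0. Qed.

Lemma increment_tail n d : `|increment n d| + 4 * eta n.+1 <= 4 * eta n.
Proof.
have h1 : `|(d %% 2 ^ n)%:R *: u n| <= eta n.
  apply: le_trans (u_small n); rewrite normrZ normr_nat.
  by rewrite ler_wpM2r// ler_nat ltnW// ltn_pmod// expn_gt0.
have := ler_normD ((d %% 2 ^ n)%:R *: u n) (y n (d %/ 2 ^ n)).
have := y_small n (d %/ 2 ^ n); have := @etaS_le R n; have := @eta_gt0 R n.+1.
by rewrite /increment; lra.
Qed.

Lemma tail_ge0 n : 0 <= 4 * @eta R n.
Proof. by rewrite mulr_ge0// ltW// eta_gt0. Qed.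

Lemma point_dist n t t' : code n t = code n t' ->
  `|point t - point t' - (increment n (digit n t) - increment n (digit n t'))|
    <= 8 * eta n.+1.
Proof.
move=> ctt'.
have -> : 8 * eta n.+1 = 2 * (4 * eta n.+1) :> R by rewrite mulrA -natrM.
apply: (@random_series_dist _ _ (fun n => 4 * eta n)) => //.
- exact: tail_ge0.
- exact: branching_gt0.
- exact: increment_tail.
Qed.

Lemma tail_cvg0 : 4 * @eta R n @[n --> \oo] --> (0 : R).
Proof. by rewrite -(mulr0 4); apply: cvgM; [exact: cvg_cst|exact: eta_cvg0]. Qed.

Lemma measurable_point_preimage (A : set (borelType X)) :
  measurable A -> measurable (point @^-1` A).
Proof.
move=> mA; rewrite -[X in measurable X]setTI.
exact: (measurable_random_series tail_ge0 tail_cvg0 branching_gt0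
  increment_tail).
Qed.

(** Once their spread points are removed, two siblings with distinct
    multiples of the probe differ by a smaller positive multiple of the probe,
    which is far from the points of M^-1 L. *)
Lemma sibling_probes n t t' p p' : L p -> L p' ->
  code n t = code n t' ->
  (digit n t' %% 2 ^ n < digit n t %% 2 ^ n)%N ->
  256 * eta n.+1 <= `|increment n (digit n t) - increment n (digit n t')
     - (y n (digit n t %/ 2 ^ n) - y n (digit n t' %/ 2 ^ n))
     - (M n)%:R^-1 *: (p - p')|.
Proof.
move=> Lp Lp' ctt' kk'; rewrite /increment.
set k := (digit n t %% _)%N in kk' *; set k' := (digit n t' %% _)%N in kk' *.
have -> (a b c d : X) : a + b - (c + d) - (b - d) = a - c.
  by rewrite opprD addrACA addrK.
rewrite -scalerBl -natrB ?(ltnW kk')//; apply: u_far; last exact: LB.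
rewrite subn_gt0 kk' (leq_trans (leq_subr _ _))// ltnW// ltn_pmod//.
by rewrite expn_gt0.
Qed.

(** The bad event of step n: x comes close to the translate of M^-1 L by v. *)
Definition near_lattice n (v : X) : set X :=
  [set x | exists2 p, L p & `|x - v - (M n)%:R^-1 *: p| < eta n.+1].

Lemma near_lattice_open n v : open (near_lattice n v).
Proof.
have -> : near_lattice n v = \bigcup_(p in L)
    [set x | `|x - v - (M n)%:R^-1 *: p| < eta n.+1].
  by apply/seteqP; split => x [p Lp px]; exists p.
apply: bigcup_open => p _.
apply: (@open_comp _ _ (fun x => `|x - v - (M n)%:R^-1 *: p|)
  [set s | s < eta n.+1]); last exact: open_lt.
move=> x _; apply: (@continuous_comp _ _ _
    (fun x => x - v - (M n)%:R^-1 *: p) Num.norm).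
  by apply: cvgB; [apply: cvgB => //|]; exact: cvg_cst.
exact: norm_continuous.
Qed.

(** If both points were close to M^-1 L, their difference, a small multiple of
    the probe up to tails, would be close to a difference of points of
    M^-1 L. *)
Lemma near_lattice_digit n v t t' :
  near_lattice n v (point t) -> near_lattice n v (point t') ->
  code n t = code n t' ->
  (digit n t %/ 2 ^ n = digit n t' %/ 2 ^ n)%N ->
  ~ (digit n t' %% 2 ^ n < digit n t %% 2 ^ n)%N.
Proof.
move=> [p Lp tp] [p' Lp' tp'] ctt' ll' kk'.
have := sibling_probes Lp Lp' ctt' kk'.
have := point_dist ctt'.
rewrite ll' (subrr (y n _)) subr0 scalerBr.
set D : X := increment n _ - _.
set a : X := _ *: p in tp *; set a' : X := _ *: p' in tp' *.
set x : X := point t in tp *; set x' : X := point t' in tp' *.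
have -> : D - (a - a') = (x - v - a) - (x' - v - a') - (x - x' - D).
  have subrACA (b c d e : X) : (b - c) - (d - e) = (b - d) - (c - e).
    by rewrite !opprB addrACA [RHS]addrACA [- d - _]addrC.
  rewrite (subrACA (x - v) a) (subrACA x v) subrr subr0.
  by rewrite (opprB (x - x')) [RHS]addrC addrA subrK.
move=> h; have := ler_normB ((x - v - a) - (x' - v - a')) (x - x' - D).
have := ler_normB (x - v - a) (x' - v - a').
have := @eta_gt0 R n.+1; lra.
Qed.

Lemma near_lattice_measure n v :
  (uniform_prob (@ltr01 R) (point @^-1` near_lattice n v) <=
    ((2 ^ n)%:R^-1)%:E)%E.
Proof.
apply: (uniform_code_parent branching_gt0 (erefl (branching n))).
  apply: measurable_point_preimage.
  by apply: open_borel; exact: near_lattice_open.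
move=> t t' Bt Bt' par.
have ctt' : code n t = code n t'.
  by rewrite (codeS branching_gt0) (codeS branching_gt0 n t')
      {2 4}/branching mulnC !divnMA par.
apply: (digit_inj branching_gt0) => //.
have ll' : (digit n t %/ 2 ^ n = digit n t' %/ 2 ^ n)%N.
  by rewrite /digit /branching -!modn_divl par.
rewrite (divn_eq (digit n t) (2 ^ n)) ll' [RHS](divn_eq _ (2 ^ n)).
congr (_ + _)%N; apply/eqP; case: ltngtP => // kk'.
  by case: (near_lattice_digit Bt' Bt (esym ctt') (esym ll') kk').
by case: (near_lattice_digit Bt Bt' ctt' ll' kk').
Qed.

(** Distinct multiples of the probe are far from each other, as 0 is in
    M^-1 L, and outweigh the spread points; equal ones cancel, and then the
    spread points are distinct. *)
Lemma point_separated n t t' : L 0 -> code n t = code n t' ->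
  code n.+1 t != code n.+1 t' -> 8 * eta n.+1 <= `|point t - point t'|.
Proof.
move=> L0.
have big (s s' : R) : code n s = code n s' ->
    (digit n s' %% 2 ^ n < digit n s %% 2 ^ n)%N ->
    8 * eta n.+1 <= `|point s - point s'|.
  move=> css' kk'.
  have := sibling_probes L0 L0 css' kk'; have := point_dist css'.
  rewrite (subrr 0) scaler0 subr0.
  set D : X := increment n _ - _.
  set b : X := y n _ - _; set F : X := point s - point s'.
  have := ler_normB (y n (digit n s %/ 2 ^ n)) (y n (digit n s' %/ 2 ^ n)).
  have := y_small n (digit n s %/ 2 ^ n).
  have := y_small n (digit n s' %/ 2 ^ n).
  rewrite -/b => h1 h2 h3 h4 h5.
  have := ler_normB D b.
  have := ler_normB F (F - D); rewrite opprB addrC subrK.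
  have := @eta_gt0 R n.+1; lra.
move=> ctt' ctt'S.
have dd' : digit n t != digit n t'.
  by apply: contra_neq ctt'S => dd'; exact: (digit_inj branching_gt0 ctt' dd').
have [kk'|kk'|kk'] := ltngtP (digit n t %% 2 ^ n) (digit n t' %% 2 ^ n).
- by rewrite distrC; exact: big.
- exact: big.
have ll' : (digit n t %/ 2 ^ n)%N != (digit n t' %/ 2 ^ n)%N.
  apply: contra_neq dd' => ll'.
  by rewrite (divn_eq (digit n t) (2 ^ n)) ll' kk' -divn_eq.
have lt (s : R) : (digit n s %/ 2 ^ n < card_spread n)%N.
  by rewrite ltn_divLR ?expn_gt0// ltn_pmod// branching_gt0.
have := y_far (lt t) (lt t') ll'; have := point_dist ctt'.
rewrite {2 3}/increment kk'.
have -> (a b c : X) : a + b - (a + c) = b - c.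
  by rewrite opprD addrACA subrr add0r.
set D : X := y n _ - _; set F : X := point t - point t'.
have := ler_normB F (F - D); rewrite opprB addrC subrK.
have := @eta_gt0 R n.+1; lra.
Qed.

(** Induction on the number of common digits: the first differing digit would
    separate the points by at least 8 eta_n. *)
Lemma point_code n t t' : L 0 ->
  `|point t - point t'| <= 2 * eta n -> code n t = code n t'.
Proof.
move=> L0 ftt'; suff : forall m, (m <= n)%N -> code m t = code m t' by apply.
elim => [|m IH] mn.
  by apply/eqP; rewrite /code card_code0 !modn1.
apply/eqP; apply/negPn/negP => cS.
have := point_separated L0 (IH (ltnW mn)) cS; have := @eta_le R _ _ mn.
have := @eta_gt0 R m.+1; lra.
Qed.

(** All the points of the series in such a ball have the same first n + 1
    digits. *)
Lemma point_cball n x r : L 0 -> r <= eta n.+1 ->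
  (uniform_prob (@ltr01 R) (point @^-1` [set z | (`|z - x| <= r)%R]) <=
    ((@eta R n.+2) ^+ n)%:E)%E.
Proof.
move=> L0 rn; set B := point @^-1` _.
have [->|/set0P[t0 Bt0]] := eqVneq B set0.
  by rewrite measure0 lee_fin exprn_ge0// ltW// eta_gt0.
apply: (@le_trans _ _ (uniform_prob (@ltr01 R)
    [set t | code n.+1 t = code n.+1 t0])).
  apply: le_measure; rewrite ?inE.
  - by apply: measurable_point_preimage; exact: measurable_cball.
  - exact: (measurable_code _ _ [set _]).
  move=> t /= Bt; apply: point_code => //.
  have -> : point t - point t0 = (point t - x) - (point t0 - x).
    by rewrite opprB addrA subrK.
  by rewrite (le_trans (ler_normB _ _))//; move: Bt Bt0; rewrite /B/=; lra.
apply: (le_trans (uniform_code branching_gt0 _ _)); rewrite lee_fin.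
rewrite -[leRHS]invrK lef_pV2 ?posrE ?invr_gt0 ?exprn_gt0 ?eta_gt0//; last first.
  by rewrite ltr0n card_code_gt0//; exact: branching_gt0.
rewrite (le_trans (ltW (truncnS_gt _)))// ler_nat card_codeS.
rewrite /branching mulnCA leq_pmulr// muln_gt0 expn_gt0 andbT.
by apply: card_code_gt0; exact: branching_gt0.
Qed.

End probing_series.

(** * From lattice distances to badly approximable points *)

Lemma latticeMn (R : realType) (X : normedModType R) (L : set X) (k : nat) p :
  lattice L -> L p -> L (k%:R *: p).
Proof.
move=> latL Lp; have L0 := lattice0 latL; have LB := latticeB latL.
elim: k => [|k IH]; first by rewrite scale0r.
rewrite -natr1 scalerDl scale1r.
have -> : k%:R *: p + p = k%:R *: p - (0 - p) by rewrite sub0r opprK.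
exact: (LB _ _ IH (LB _ _ L0 Lp)).
Qed.

Lemma Hstd_spec (R : realType) (X : normedModType R) (L : set X) r :
  rational_points L r -> (0 < Hstd L r)%N /\ L ((Hstd L r)%:R *: r).
Proof.
move=> [p [q [Lp q0 ->]]].
set r' := q%:R^-1 *: p; rewrite /Hstd; set A := [set _ | _].
suff [q1 Aq1] : A !=set0 by have [] := @xgetPex _ 0%N A (ex_intro _ q1 Aq1).
have ex : exists m, (0 < m)%N && `[< L (m%:R *: r') >].
  exists q; rewrite q0; apply/asboolP.
  by rewrite scalerA mulfV ?scale1r// pnatr_eq0 -lt0n.
case: (ex_minnP ex) => m /andP[m0 /asboolP Lm] mmin.
exists m; split => // q' q'0 Lq'; apply: mmin.
by rewrite q'0; apply/asboolP.
Qed.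

(** A denominator q is handled at the first scale j >= j0 such that
    q <= m_j, where q^-1 L is contained in (m_j)!^-1 L.  If j > j0 then
    q > m_(j-1), so psi (q) <= c_j; the finitely many q <= m_(j0) are absorbed
    by the constant. *)
Lemma badly_approximable_scales (R : realType) (X : normedModType R)
    (L : set X) (psi : R -> R) (c : nat -> R) (m : nat -> nat) (x : X) j0 :
  lattice L -> (forall q, 0 < q -> 0 < psi q) -> (forall j, 0 < c j) ->
  (forall j, (j <= m j)%N) ->
  (forall j q, (m j < q)%N -> psi q%:R <= c j.+1) ->
  (forall j p, (j0 <= j)%N -> L p -> c j <= `|x - (m j)`!%:R^-1 *: p|) ->
  badly_approximable (rational_points L) (fun r => (Hstd L r)%:R) psi x.
Proof.
move=> latL psi0 c0 mge psic far.
pose S := \sum_(i < m j0) psi i.+1%:R.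
have psiS (q : nat) : (0 < q)%N -> (q <= m j0)%N -> psi q%:R <= S.
  case: q => // q _ qm; rewrite /S (bigD1 (Ordinal qm))//= lerDl.
  by apply: sumr_ge0 => i _; rewrite ltW// psi0.
have S0 : 0 <= S by apply: sumr_ge0 => i _; rewrite ltW// psi0.
pose e := Num.min 1 (c j0 / (1 + S)).
have S1 : 0 < 1 + S by rewrite ltr_wpDr.
have e0 : 0 < e by rewrite lt_min ltr01 divr_gt0.
exists e => // r Qr.
have [H0 LH] := Hstd_spec Qr.
set q := Hstd L r in H0 LH *.
have psiq : 0 < psi q%:R by rewrite psi0// ltr0n.
have rfar j : (j0 <= j)%N -> (q <= m j)%N -> c j <= `|r - x|.
  move=> j0j qm; have dv : (q %| (m j)`!)%N by rewrite dvdn_fact// H0.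
  have := far j _ j0j (latticeMn ((m j)`! %/ q) latL LH).
  have fj : (m j)`!%:R != 0 :> R by rewrite pnatr_eq0 -lt0n fact_gt0.
  rewrite [in X in _ <= X -> _]scalerA -natrM divnK// scalerA mulVf//.
  by rewrite scale1r distrC.
have [qm|qm] := leqP q (m j0).
  apply: le_trans (rfar _ (leqnn _) qm).
  apply: (@le_trans _ _ (c j0 / (1 + S) * psi q%:R)).
    by rewrite ler_pM2r// /e ge_min lexx orbT.
  rewrite mulrAC ler_pdivrMr// ler_pM2l//.
  by rewrite (le_trans (psiS _ H0 qm))// lerDr.
have ex : exists j, (j0 <= j)%N && (q <= m j)%N.
  by exists (j0 + q)%N; rewrite leq_addr (leq_trans _ (mge _))// leq_addl.
case: (ex_minnP ex) => -[|j] /andP[j0j qmj] jmin.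
  by move: qmj; rewrite leqn0 in j0j; rewrite -(eqP j0j) leqNgt qm.
have mjq : (m j < q)%N.
  rewrite ltnNge; apply/negP => qmj'.
  move: j0j; rewrite leq_eqVlt => /predU1P[jj|j0j'].
    by move: qm; rewrite jj ltnNge qmj.
  by have := jmin j; rewrite -ltnS j0j' qmj' ltnn => /(_ isT).
apply: le_trans (rfar _ j0j qmj); apply: le_trans (psic _ _ mjq).
by rewrite ler_piMl ?(ltW psiq)// /e ge_min lexx.
Qed.

Lemma psi_scale (R : realType) (psi : R -> R) (c : R) :
  psi q @[q --> +oo] --> (0 : R) -> 0 < c ->
  exists m, forall q : nat, (m <= q)%N -> psi q%:R <= c.
Proof.
move=> /cvgrPdist_le/(_ _ _)/[apply] -[A [_ Ac]].
exists (Num.truncn A).+1 => q Aq.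
have := Ac q%:R; rewrite sub0r normrN => h.
apply: le_trans (ler_norm _) (h _).
by apply: lt_le_trans (truncnS_gt _) _; rewrite ler_nat.
Qed.

Theorem theorem3p1 (R : realType) (X : completeNormedModType R)
  (infX : ~ finite_dimensional X)
  (L : set X) (latL : lattice L) (ncbL : ~ cobounded L)
  (psi : R -> R) (psi_gt0 : forall q : R, 0 < q -> 0 < psi q)
  (psi_cvg0 : psi q @[q --> +oo] --> (0 : R)) :
  let BA := badly_approximable (rational_points L)
              (fun r => (Hstd L r)%:R) psi in
  prevalent BA /\ hausdorff_dim BA = +oo%E.
Proof.
move=> BA.
have L0 := lattice0 latL; have LB := latticeB latL.
have [h hP] := choice (fun j => psi_scale psi_cvg0 (@eta_gt0 R j.+1)).
(* The summand j makes m unbounded, so that every denominator is covered. *)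
pose m j := (h j.+1 + j)%N.
pose M j := (m j)`!.
have [u uP] := choice (fun j => noncobounded_probe ncbL (ex_intro _ 0 L0) LB
  (fact_gt0 (m j)) (expn_gt0 2 j) (@eta_gt0 R j)).
have rho0 j : 0 < 32 * @eta R j.+1 by rewrite mulr_gt0 ?ltr0n ?eta_gt0.
have [y yP] := choice (fun j =>
  separated_points (@card_spread R j) infX (rho0 j)).
have u_small j : (2 ^ j)%:R * `|u j| <= eta j by have [] := uP j.
have u_far j k p : (0 < k <= 2 ^ j)%N -> L p ->
    256 * eta j.+1 <= `|k%:R *: u j - (M j)%:R^-1 *: p|.
  move=> kj Lp; have [_ /(_ k p kj Lp)] := uP j; apply: le_trans.
  have j2 : 2 ^+ j != 0 :> R by rewrite expf_neq0// pnatr_eq0.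
  rewrite (etaS j) natrX le_eqVlt; apply/orP; left; apply/eqP.
  by field.
have y_small j l : `|y j l| <= 32 * eta j.+1 by have [] := yP j.
have y_far j l l' : (l < @card_spread R j)%N -> (l' < @card_spread R j)%N ->
    l != l' -> 16 * eta j.+1 <= `|y j l - y j l'|.
  have [_ ysep] := yP j => ll ll' ne; apply: le_trans (ysep _ _ ll ll' ne).
  by lra.
have [mu mu_compact muE] := random_series_law tail_ge0 tail_cvg0
  (@branching_gt0 R) (increment_tail u_small y_small).
have BAP x v : ~ lim_sup_set (fun j => @near_lattice R X L M j v) x ->
    BA (x - v).
  move=> /existsNP[j0 /not_implyP[_ near]].
  apply: (@badly_approximable_scales _ _ L psi (fun j => eta j.+1) m
      (x - v) j0)
    => //.
  - by move=> j; exact: eta_gt0.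
  - by move=> j; rewrite leq_addl.
  - by move=> j q jq; apply: hP; rewrite (leq_trans _ (ltnW jq))// leq_addr.
  move=> j p j0j Lp; rewrite leNgt; apply/negP => near'.
  by apply: near; exists j => //; exists p.
have mu_near v : mu (lim_sup_set (fun j => @near_lattice R X L M j v)) = 0%E.
  have le2 j : (mu (@near_lattice R X L M j v) <=
      (2 / (2 ^ j.+1)%:R)%:E)%E.
    rewrite muE.
    apply: le_trans (near_lattice_measure LB u_small u_far y_small j v) _.
    by rewrite lee_fin expnS natrM invfM mulrA mulfV ?mul1r.
  apply: lim_sup_set_cvg0.
    by move=> j; apply: open_borel; exact: near_lattice_open.
  apply: (@le_lt_trans _ _ (\sum_(j <oo) (2 / (2 ^ j.+1)%:R)%:E)%E).
    by apply: lee_nneseries => // j *; exact: le2.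
  by apply: (le_lt_trans (epsilon_trick0 xpredT _)); rewrite ?ltry.
have trans : transverse mu (~` BA).
  move=> v; exists (lim_sup_set (fun j => @near_lattice R X L M j v)); split.
  - apply: bigcap_measurable => // k _; apply: bigcup_measurable => j _.
    by apply: open_borel; exact: near_lattice_open.
  - exact: mu_near.
  move=> _ [s nBA <-]; apply: contrapT => nlim; apply: nBA.
  by have := BAP _ _ nlim; rewrite addrK.
split; first by exists mu.
apply: (@hausdorff_dim_frostman _ _ mu).
  have := trans 0; rewrite (_ : [set _ | _ in _] = ~` BA)//.
  by under eq_imagel do rewrite addr0; rewrite image_id.
move=> s s0.
pose j := (Num.truncn s).+1.
have sj : s <= j%:R by exact/ltW/truncnS_gt.
exists (eta j.+1) => [|x r /andP[r0 rj]]; first exact: eta_gt0.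
(* The scale n with eta_(n+2) < r <= eta_(n+1): the ball has mass at most
   eta_(n+2) ^ n <= r ^ n <= r ^ s. *)
have ex : exists n, @eta R n.+2 < r.
  have /cvgrPdist_lt/(_ _ r0)[n _ /(_ n.+2)] := @eta_cvg0 R.
  rewrite sub0r normrN ger0_norm ?(ltW (eta_gt0 _))// => nr.
  by exists n; apply: nr => /=; rewrite -addn2 leq_addr.
case: (ex_minnP ex) => n nr nmin.
have rn : r <= eta n.+1.
  case: n nr nmin => [|n] nr nmin; first by rewrite (le_trans rj)// eta_le.
  by rewrite leNgt; apply/negP => /nmin; rewrite ltnn.
have jn : (j <= n)%N.
  rewrite leqNgt; apply/negP => nj.
  by have := lt_le_trans nr rj; rewrite ltNge eta_le.
rewrite muE.
apply: le_trans (point_cball LB u_small u_far y_small y_far x L0 rn) _.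
rewrite lee_fin.
apply: (@le_trans _ _ (r ^+ n)).
  by rewrite lerXn2r ?nnegrE ?(ltW (eta_gt0 _)) ?ltW.
rewrite -powR_mulrn ?(ltW r0)//; apply: ger_powR.
  by rewrite r0 (le_trans rn)// eta_le1.
by rewrite (le_trans sj)// ler_nat.
Qed.
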